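(* Let $X\subset\mathbb R^n$ be a nonempty set, let $f=(f_1,\dots,f_m)^T:X\to\mathbb R^m$ be a function, and let $\varepsilon=(\varepsilon_1,\dots,\varepsilon_m)\in\mathbb R^m_+$. Consider the vector optimization problem (VP) of minimizing $f(x)$ subject to $x\in X$, with ordering cone $K=\mathbb R^m_+$. For every $\bar x\in X$, the following three conditions are equivalent: (i) $\bar x$ is an $\varepsilon$-properly efficient solution of (VP); (ii) $\overline{\rm cone}\big[f(X)+\mathbb R^m_+-(f(\bar x)-\varepsilon)\big]\cap\big(-\mathbb R^m_+\big)=\{0\}$; (iii) $\overline{\rm cone}\big[f(X)-(f(\bar x)-\varepsilon)\big]\cap\big(-\mathbb R^m_+\big)=\{0\}$.
   Context: $\mathbb R^m_+$ is the nonnegative orthant of $\mathbb R^m$, and $I=\{1,\dots,m\}$. A nonempty set $C\subset\mathbb R^m$ is a cone if $tv\in C$ for all $v\in C$ and $t\ge 0$ (convexity is not required). For a nonempty set $D\subset\mathbb R^m$, ${\rm cone}\,D$ is the smallest cone containing $D$, i.e. ${\rm cone}\,D=\{td: t\ge 0,\ d\in D\}$, and $\overline{\rm cone}\,D$ is its topological closure. For a vector $v$, $D-v=\{d-v: d\in D\}$, and $D+\mathbb R^m_+$ is the Minkowski sum. With ordering cone $K$, $y^1\le_K y^2$ means $y^2-y^1\in K$; here $K=\mathbb R^m_+$, so this is the componentwise order. A point $x\in X$ is an $\varepsilon$-efficient solution of (VP) if there is no $y\in X$ such that $f(y)\le_K f(x)-\varepsilon$ and $f(y)\ne f(x)-\varepsilon$.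 The set of these points is $E_\varepsilon$. A point $\bar x\in E_\varepsilon$ is an $\varepsilon$-properly efficient solution of (VP) (case $K=\mathbb R^m_+$) if there exists a scalar $M>0$ such that, for each $i\in I$, whenever $x\in X$ and $f_i(x)<f_i(\bar x)-\varepsilon_i$ there is an index $j\in I$ such that $f_j(x)>f_j(\bar x)-\varepsilon_j$ and $$\frac{f_i(\bar x)-f_i(x)-\varepsilon_i}{f_j(x)-f_j(\bar x)+\varepsilon_j}\le M.$$ In particular, an $\varepsilon$-properly efficient solution belongs to $E_\varepsilon$ by definition. *)

(* Defs.v *)
From HB Require Import structures.
From mathcomp Require Import all_boot all_order all_algebra.
From mathcomp Require Import all_classical all_reals all_analysis.
Set Implicit Arguments.
Unset Strict Implicit.
Unset Printing Implicit Defensive.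
Import Order.TTheory GRing.Theory Num.Theory.
Import numFieldNormedType.Exports.
Local Open Scope classical_set_scope.
Local Open Scope ring_scope.

(* Points of R^n are row vectors, with coordinates v 0 i for i : 'I_n; their
   topology is the product topology that the library puts on matrices. *)

Definition orthant (R : realType) (m : nat) : set 'rV[R]_m :=
  [set v | forall i, 0 <= v 0 i].
Arguments orthant : clear implicits.

Definition is_cone (R : realType) (m : nat) (C : set 'rV[R]_m) : Prop :=
  C !=set0 /\ forall v t, C v -> 0 <= t -> C (t *: v).

Definition cone (R : realType) (m : nat) (D : set 'rV[R]_m) : set 'rV[R]_m :=
  [set t *: d | t in [set t : R | 0 <= t] & d in D].

Lemma cone_smallest (R : realType) (m : nat) (D : set 'rV[R]_m) :
  D !=set0 -> cone D = smallest (@is_cone R m) D.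
Proof.
move=> D0; apply/seteqP; split=> [_ [t t0 [d Dd <-]] C [[_ CZ] DC]|v].
  by apply: CZ => //; exact: DC.
apply; split=> [|d Dd]; last by exists 1; [exact: ler01 | exists d; rewrite ?scale1r].
split=> [|_ s [t t0 [d Dd <-]] s0].
  by case: D0 => d Dd; exists (0 *: d); exists 0; [exact: lexx | exists d].
by exists (s * t); [exact: mulr_ge0 | exists d; rewrite ?scalerA].
Qed.

Definition minkowski_sum (R : realType) (m : nat) (A B : set 'rV[R]_m) : set 'rV[R]_m :=
  [set a + b | a in A & b in B].

Definition translate_sub (R : realType) (m : nat) (D : set 'rV[R]_m)
    (v : 'rV[R]_m) : set 'rV[R]_m :=
  [set d - v | d in D].

Definition cone_le (R : realType) (m : nat) (K : set 'rV[R]_m)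
    (y1 y2 : 'rV[R]_m) : Prop :=
  K (y2 - y1).

(* The objective f : X -> R^m is represented by a function on all of R^n;
   only its values on X are used. *)

Definition eps_efficient (R : realType) (n m : nat) (K : set 'rV[R]_m)
    (X : set 'rV[R]_n) (f : 'rV[R]_n -> 'rV[R]_m) (eps : 'rV[R]_m) :
    set 'rV[R]_n :=
  [set x | X x /\
    ~ exists y, [/\ X y, cone_le K (f y) (f x - eps) & f y <> f x - eps]].

Definition eps_properly_efficient (R : realType) (n m : nat)
    (X : set 'rV[R]_n) (f : 'rV[R]_n -> 'rV[R]_m) (eps : 'rV[R]_m)
    (xbar : 'rV[R]_n) : Prop :=
  eps_efficient (orthant R m) X f eps xbar /\
  exists2 M : R, 0 < M &
    forall (i : 'I_m) (x : 'rV[R]_n), X x ->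
      f x 0 i < f xbar 0 i - eps 0 i ->
      exists2 j : 'I_m, f x 0 j > f xbar 0 j - eps 0 j &
        (f xbar 0 i - f x 0 i - eps 0 i) / (f x 0 j - f xbar 0 j + eps 0 j)
          <= M.

(* Main.v *)
Require Import Defs.
From HB Require Import structures.
From mathcomp Require Import all_boot all_order all_algebra.
From mathcomp Require Import all_classical all_reals all_analysis.
From mathcomp Require Import lra.
Import Order.TTheory GRing.Theory Num.Theory.
Import numFieldNormedType.Exports.
Local Open Scope classical_set_scope.
Local Open Scope ring_scope.

(** Write [D = f(X) - (f(xbar) - eps)]. Proper efficiency says that the ratios
    of the negative entries of a [d] in [D] to some positive entry of [d] are
    bounded by [M]. This survives adding orthant vectors and scaling, so a
    point of the generated cone close to [- v] with [v >= 0], [v_i > 0] would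
    have an entry of size about [v_i / M], whereas all its entries are almost
    nonpositive. Conversely, if the closed cone generated by [D] meets the
    negative orthant only at [0], the sum of the positive parts of the
    coordinates is positive on its compact trace on the unit sphere; its minimum
    there yields the bound [M]. *)

(** The ratio clause of proper efficiency, read on the differences [d = f x - (f xbar - eps)], so
    that the rest of the argument concerns a set [D] alone. *)
Definition bounded_ratio (R : realType) (m : nat) (D : set 'rV[R]_m) (M : R) :=
  forall (d : 'rV[R]_m) (i : 'I_m), D d -> d 0 i < 0 ->
    exists2 j, 0 < d 0 j & - d 0 i / d 0 j <= M.
Arguments bounded_ratio {R m}.

Lemma sub_cone (R : realType) (m : nat) (A B : set 'rV[R]_m) :
  A `<=` B -> cone A `<=` cone B.
Proof. by move=> AB _ [t t0 [d Ad <-]]; exists t => //; exists d => //; exact: AB. Qed.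

Lemma oppr_orthantP (R : realType) (m : nat) (w : 'rV[R]_m) :
  [set - v | v in orthant R m] w <-> forall i, w 0 i <= 0.
Proof.
split=> [[v v0 <-] i|w0]; first by rewrite mxE oppr_le0; exact: v0.
by exists (- w); [move=> i; rewrite mxE oppr_ge0 | rewrite opprK].
Qed.

Lemma closure_cone0 (R : realType) (m : nat) (D : set 'rV[R]_m) :
  D !=set0 -> closure (cone D) 0.
Proof.
move=> [d Dd]; apply: subset_closure; exists 0; first exact: lexx.
by exists d; rewrite ?scale0r.
Qed.

Lemma closure_coneZ (R : realType) (m : nat) (D : set 'rV[R]_m) (t : R) (d : 'rV[R]_m) :
  0 <= t -> D d -> closure (cone D) (t *: d).
Proof. by move=> t0 Dd; apply: subset_closure; exists t => //; exists d. Qed.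

Lemma translate_minkowski (R : realType) (m : nat) (A B : set 'rV[R]_m) (v : 'rV[R]_m) :
  translate_sub (minkowski_sum A B) v = minkowski_sum (translate_sub A v) B.
Proof.
apply/seteqP; split=> [_ [_ [a Aa [b Bb <-]] <-]|_ [_ [a Aa <-] [b Bb <-]]].
  by exists (a - v); [exists a | exists b; rewrite // addrAC].
by exists (a + b); [exists a => //; exists b | rewrite addrAC].
Qed.

Lemma subset_minkowski_orthant (R : realType) (m : nat) (D : set 'rV[R]_m) :
  D `<=` minkowski_sum D (orthant R m).
Proof. by move=> d Dd; exists d => //; exists 0; rewrite ?addr0// => i; rewrite mxE. Qed.

Lemma bounded_ratio_closure_cone (R : realType) (m : nat) (D : set 'rV[R]_m) (M : R) :
  D !=set0 -> 0 < M -> bounded_ratio D M ->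
  closure (cone (minkowski_sum D (orthant R m)))
    `&` [set - v | v in orthant R m] = [set 0].
Proof.
move=> D0 M0 ratioD; apply/seteqP; split=> [w [clw /oppr_orthantP w_le0]|_ ->]; last first.
  split; last by apply/oppr_orthantP => i; rewrite mxE.
  apply: closure_cone0; have [d Dd] := D0.
  by exists d; exact: subset_minkowski_orthant.
apply/rowP => i; rewrite mxE; apply/eqP; rewrite eq_le w_le0 leNgt; apply/negP => wi_lt0.
(* The radius solves [w_i + e = - M * e]. A cone point [t * (d + r)] within [e] of [w] then has
   [t * d_i < - M * e], so the ratio bound forces [t * d_j > e], whereas [w_j <= 0] forces
   [t * d_j < e]. *)
pose e := - w 0 i / (1 + M).
have M1 : 0 < 1 + M by lra.
have e0 : 0 < e by rewrite divr_gt0 ?oppr_gt0.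
have eM : e * (1 + M) = - w 0 i by rewrite divfK// gt_eqF.
have [_ [[t /= t0 [_ [d Dd [r r0 <-]] <-]] [_ near_w]]] := clw _ (nbhsx_ballx w e e0).
have near_wk k : `|w 0 k - t * (d 0 k + r 0 k)| < e.
  by have := near_w 0 k; rewrite /ball /= !mxE.
have tgt0 : 0 < t.
  rewrite lt_def t0 andbT; apply/eqP => t_eq0.
  by have := near_wk i; rewrite t_eq0 mul0r subr0 ltr_norml; nra.
have di_lt0 : d 0 i < 0.
  have := near_wk i; rewrite ltr_norml => /andP[near_wi _].
  have ri := r0 i; have tri := mulr_ge0 t0 ri.
  have eM0 := mulr_gt0 e0 M0.
  rewrite -(pmulr_rlt0 _ tgt0); lra.
have [j dj_gt0 dij] := ratioD d i Dd di_lt0.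
have {}dij : - d 0 i <= M * d 0 j by rewrite -ler_pdivrMr.
have := near_wk j; rewrite ltr_norml => /andP[near_wj _].
have := near_wk i; rewrite ltr_norml => /andP[near_wi _].
have tri := mulr_ge0 t0 (r0 i); have trj := mulr_ge0 t0 (r0 j).
have tdij := ler_wpM2l t0 dij.
have wj := w_le0 j.
have tdj : t * d 0 j < e by lra.
have Mtdj : M * (t * d 0 j) < M * e by rewrite ltr_pM2l.
lra.
Qed.

(** This sum is nonnegative and vanishes exactly on the negative orthant, so it measures how far a
    vector is from lying there. *)
Lemma continuous_sum_pospart (R : realType) (m : nat) :
  continuous (fun w : 'rV[R]_m => \sum_j Num.max (w 0 j) 0).
Proof.
apply: continuous_big => [|j _ w]; first exact: add_continuous.
apply: continuous_max; first exact: coord_continuous.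
exact: cst_continuous.
Qed.

Lemma le_coord_norm (R : realType) (m : nat) (w : 'rV[R]_m) (i : 'I_m) :
  `|w 0 i| <= `|w|.
Proof.
by rewrite {2}/Num.norm /= mx_normrE; exact: (le_bigmax _ (fun ij => `|w ij.1 ij.2|) (0, i)).
Qed.

Lemma closure_cone_bounded_ratio (R : realType) (m : nat) (D : set 'rV[R]_m) :
  closure (cone D) `&` [set - v | v in orthant R m] `<=` [set 0] ->
  exists2 M, 0 < M & bounded_ratio D M.
Proof.
move=> clD.
pose A := closure (cone D) `&` [set w : 'rV[R]_m | `|w| = 1].
have cptA : compact A.
  apply: bounded_closed_compact.
    by exists 1; split=> [|x x1 w [_ /= ->]]; [exact: num_real | exact: ltW].
  apply: closedI; first exact: closed_closure.
  exact: (closed_comp (fun w _ => @norm_continuous _ _ w) (@closed_eq _ 1)).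
pose g (w : 'rV[R]_m) := \sum_j Num.max (w 0 j) 0.
have g_gt0 w : A w -> 0 < g w.
  move=> [clw /= w1]; rewrite lt_def sumr_ge0 ?andbT; last first.
    by move=> j _; rewrite le_max lexx orbT.
  (* If all positive parts vanish, [w] lies in the negative orthant, hence is [0] by [clD], against
     [w1]. *)
  apply/negP; rewrite psumr_eq0 => [/allP g0|j _]; last by rewrite le_max lexx orbT.
  have w0 : w = 0.
    apply: clD; split=> //; apply/oppr_orthantP => j.
    by have /eqP <- := g0 j (mem_index_enum j); rewrite le_max lexx.
  by move: w1; rewrite w0 normr0 => /esym/eqP; rewrite oner_eq0.
have [c c0 gA] : exists2 c, 0 < c & forall w, A w -> c <= g w.
  (* [A] can be empty, for instance when [D] is [{0}]; any positive [c] then works. *)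
  have [A0|/set0P/negP] := pselect (A !=set0); last first.
    by rewrite negbK => /eqP ->; exists 1.
  have ctg : {within A, continuous g}.
    exact/continuous_subspaceT/continuous_sum_pospart.
  have [w /set_mem Aw gw] := compact_EVT_min A0 cptA ctg.
  by exists (g w); [exact: g_gt0 | move=> v /mem_set; exact: gw].
(* For [m = 0] the constant [m / c] would not be positive, but there is no coordinate to check. *)
have [m0|m_gt0] := posnP m.
  by exists 1 => // d i; exfalso; move: i; rewrite m0 => -[].
exists (m%:R / c); first by rewrite divr_gt0// ltr0n.
move=> d i Dd di_lt0.
have nd_gt0 : 0 < `|d|.
  by rewrite normr_gt0; apply: contraTneq di_lt0 => ->; rewrite mxE ltxx.
have := gA (`|d|^-1 *: d).
(* If every [d_j] were below [c * |d| / m], the [m] positive parts of the normalized [d] would sum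
   to less than the minimum [c]. So some [d_j] is at least [c * |d| / m], and [- d_i <= |d|] gives
   the ratio bound [m / c]. *)
case: (boolP [forall j, d 0 j * m%:R < c * `|d|]) => [/forallP small|]; last first.
  rewrite negb_forall => /existsP[j]; rewrite -leNgt => dj _.
  have m0 : 0 < m%:R :> R by rewrite ltr0n.
  have dj_gt0 : 0 < d 0 j by rewrite -(pmulr_lgt0 _ m0) (lt_le_trans _ dj)// mulr_gt0.
  exists j => //; rewrite ler_pdivrMr// mulrAC ler_pdivlMr//.
  rewrite [leRHS]mulrC (le_trans _ dj)// mulrC ler_pM2l//.
  by rewrite (le_trans _ (le_coord_norm _ _ d i))// -normrN ler_norm.
suff g_lt : g (`|d|^-1 *: d) < c.
  move=> /(_ _)/wrap[]; last by move=> /(lt_le_trans g_lt); rewrite ltxx.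
  split; first by apply: closure_coneZ; rewrite // invr_ge0.
  by rewrite /= mx_normZ ger0_norm ?invr_ge0// mulVf// gt_eqF.
have -> : c = \sum_(j < m) c / m%:R.
  by rewrite sumr_const card_ord -[(c / _) *+ _]mulr_natr divfK// pnatr_eq0 -lt0n.
apply: ltr_sum; first by apply/hasP; exists i.
move=> j _; rewrite mxE gt_max divr_gt0 ?ltr0n// andbT.
by rewrite ltr_pdivlMr ?ltr0n// -mulrA mulrC ltr_pdivrMr// small.
Qed.

Theorem theorem3p3 (R : realType) (n m : nat) (X : set 'rV[R]_n)
    (X_neq0 : X !=set0) (f : 'rV[R]_n -> 'rV[R]_m) (eps : 'rV[R]_m)
    (eps_ge0 : orthant R m eps) (xbar : 'rV[R]_n) (Xxbar : X xbar) :
  let cond_i := eps_properly_efficient X f eps xbar in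
  let cond_ii :=
    closure (cone (translate_sub (minkowski_sum (f @` X) (orthant R m))
                           (f xbar - eps)))
      `&` [set - v | v in orthant R m] = [set 0] in
  let cond_iii :=
    closure (cone (translate_sub (f @` X) (f xbar - eps)))
      `&` [set - v | v in orthant R m] = [set 0] in
  (cond_i <-> cond_ii) /\ (cond_ii <-> cond_iii).
Proof.
move=> cond_i cond_ii cond_iii.
pose D := translate_sub (f @` X) (f xbar - eps).
have D0 : D !=set0 by exists (f xbar - (f xbar - eps)), (f xbar) => //; exists xbar.
have i_ii : cond_i -> cond_ii.
  move=> [_ [M M0 fM]]; rewrite /cond_ii translate_minkowski.
  apply: (@bounded_ratio_closure_cone _ _ _ M) => //.
  move=> _ i [_ [x Xx <-] <-]; rewrite !mxE subr_lt0 => fxi.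
  have [j fxj ratio] := fM i x Xx fxi.
  exists j; rewrite !mxE; first by rewrite subr_gt0.
  by move: ratio; congr (_ / _ <= _); lra.
have ii_iii : cond_ii -> cond_iii.
  rewrite /cond_ii /cond_iii translate_minkowski => /seteqP[cone_ii _].
  apply/seteqP; split=> [w [clw w_le0]|_ ->].
    apply: cone_ii; split=> //; apply: closure_subset clw.
    exact/sub_cone/subset_minkowski_orthant.
  by split; [exact: closure_cone0 | apply/oppr_orthantP => i; rewrite mxE].
have iii_i : cond_iii -> cond_i.
  move=> /seteqP[cone_iii _]; split.
    (* A point [y] violating efficiency puts [f y - (f xbar - eps)] in both the cone (with scalar
       [1]) and the negative orthant, so this difference is [0]. *)
    split=> // -[y [Xy le_y]]; apply; apply/eqP; rewrite -subr_eq0; apply/eqP.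
    apply: cone_iii; split.
      by rewrite -[f y - _]scale1r; apply: closure_coneZ => //; exists (f y) => //; exists y.
    by exists (f xbar - eps - f y) => //; rewrite opprB.
  have [M M0 ratioD] := @closure_cone_bounded_ratio _ _ D cone_iii.
  exists M => // i x Xx fxi.
  have Dx : D (f x - (f xbar - eps)) by exists (f x) => //; exists x.
  have [|j] := ratioD _ i Dx; rewrite !mxE ?subr_lt0 ?subr_gt0// => fxj ratio.
  by exists j => //; move: ratio; congr (_ / _ <= _); lra.
by split; split=> // h; [exact/iii_i/ii_iii | exact/i_ii/iii_i].
Qed.
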